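(* Let $n\ge1$, let $V\subseteq(\mathbb{C}^n)^{\otimes n}$ be an $S_n$-submodule, and let $\chi_V$ be its character, $\chi_V(\sigma)=\operatorname{trace}(\sigma|_V)$ for $\sigma\in S_n$. Then for every $n\times n$ complex matrix $A$, $$\operatorname{trace}\bigl(E_A^n\big|_V\bigr)=\sum_{\sigma\in S_n}\chi_V(\sigma)\int_{U_n}\prod_{i=1}^n A^u_{i\,\sigma(i)}\,du.$$
   Context: Let $v_1,\dots,v_n$ be the standard orthonormal basis of $\mathbb{C}^n$. The symmetric group $S_n$ acts on $(\mathbb{C}^n)^{\otimes n}$ by $\sigma(v_{i_1}\otimes\cdots\otimes v_{i_n})=v_{i_{\sigma^{-1}(1)}}\otimes\cdots\otimes v_{i_{\sigma^{-1}(n)}}$. An $n\times n$ matrix $B$ acts by $B^{\otimes n}(v_{i_1}\otimes\cdots\otimes v_{i_n})=Bv_{i_1}\otimes\cdots\otimes Bv_{i_n}$. Let $du$ be the normalized Haar measure on the unitary group $U_n$, write $A^u=uAu^{*}$ for $u\in U_n$, and define $E_A^n=\int_{U_n}(A^u)^{\otimes n}\,du$, an operator on $(\mathbb{C}^n)^{\otimes n}$. This operator maps every $S_n$-submodule of $(\mathbb{C}^n)^{\otimes n}$ into itself, so the trace on $V$ is defined. *)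

(* Defs.v *)
From HB Require Import structures.
From mathcomp Require Import all_boot all_order all_algebra all_fingroup.
From mathcomp Require Import spectral complex.
From mathcomp Require Import all_classical all_reals all_analysis.

Set Implicit Arguments.
Unset Strict Implicit.
Unset Printing Implicit Defensive.
Import Order.TTheory GRing.Theory Num.Theory.
Import numFieldNormedType.Exports.
Local Open Scope classical_set_scope.
Local Open Scope ring_scope.
Local Open Scope sesquilinear_scope.

(* Packing R[i] as a [numClosedFieldType] makes its norm topology, and its
   structure of vector space over itself, available by inference. *)
Definition C (R : realType) : numClosedFieldType := R[i]%C.

Definition unitary (R : realType) (n : nat) : Type :=
  {u : 'M[C R]_n | u \is unitarymx}.

Section UnitaryGroup.
Variables (R : realType) (n : nat).

HB.instance Definition _ := SubChoice.on (unitary R n).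

Lemma unitary1_subproof : (1%:M : 'M[C R]_n) \is unitarymx.
Proof. by apply/unitarymxP; rewrite mul1mx trmx1 map_mx1. Qed.

HB.instance Definition _ := isPointed.Build (unitary R n)
  (exist _ 1%:M unitary1_subproof).

HB.instance Definition _ := Topological.copy (unitary R n)
  (initial_topology (val : unitary R n -> 'M[C R]_n)).

HB.instance Definition _ := Measurable.copy (unitary R n)
  (g_sigma_algebraType (@open (unitary R n))).

Lemma unitaryM_subproof (w u : unitary R n) : val w *m val u \is unitarymx.
Proof. exact: mul_unitarymx (valP w) (valP u). Qed.

Definition unitaryM (w u : unitary R n) : unitary R n :=
  exist _ (val w *m val u) (unitaryM_subproof w u).

Definition conj_unitary (A : 'M[C R]_n) (u : unitary R n) : 'M[C R]_n :=
  val u *m A *m (val u)^t*.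

End UnitaryGroup.

(* On the compact group U_n a left-invariant Borel probability measure is
   automatically right-invariant and regular, and it is unique. *)
Definition is_haar (R : realType) (n : nat)
    (mu : probability (unitary R n) R) : Prop :=
  forall (w : unitary R n) (B : set (unitary R n)),
    measurable B -> mu (unitaryM w @^-1` B) = mu B.

Definition cintegral (d : measure_display) (T : measurableType d) (R : realType)
    (mu : {measure set T -> \bar R}) (f : T -> C R) : C R :=
  Complex (Rintegral mu setT (fun x => complex.Re (f x)))
          (Rintegral mu setT (fun x => complex.Im (f x))).

(* An element of the n-th tensor power of C^n is the family of its coordinates
   in the basis v_{i_1} (x) ... (x) v_{i_n}, indexed by i : 'I_n -> 'I_n. *)
Definition multiindex (n : nat) := {ffun 'I_n -> 'I_n}.
Definition tensor (R : realType) (n : nat) : vectType (C R) :=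
  {ffun multiindex n -> C R}.

Section Tensors.
Variables (R : realType) (n : nat).

Definition pure_tensor (x : 'I_n -> 'cV[C R]_n) : tensor R n :=
  [ffun j : multiindex n => \prod_(k < n) x k (j k) 0].

Definition stdbasis (k : 'I_n) : 'cV[C R]_n := delta_mx k 0.

Definition basis_tensor (i : multiindex n) : tensor R n :=
  pure_tensor (fun k => stdbasis (i k)).

(* The linear endomorphism sending [basis_tensor i] to [F i]; see
   [lin_ext_basis]. *)
Definition lin_ext (F : multiindex n -> tensor R n) : 'End(tensor R n) :=
  linfun (fun t : {ffun multiindex n -> C R} =>
    \sum_(i : multiindex n) t i *: F i).

Lemma basis_tensorE (i j : multiindex n) :
  (basis_tensor i : {ffun _ -> _}) j = (j == i)%:R.
Proof.
rewrite ffunE; have [->|/eqP neq] := eqVneq j i.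
  by rewrite big1 // => k _; rewrite mxE !eqxx.
have [k nk] : exists k, j k != i k.
  apply/existsP; rewrite -negb_forall; apply/forallP => h.
  by apply: neq; apply/ffunP => k; apply/eqP.
by rewrite (bigD1 k) //= mxE (negPf nk) mul0r.
Qed.

Lemma lin_ext_basis F (i : multiindex n) : lin_ext F (basis_tensor i) = F i.
Proof.
pose f (t : {ffun multiindex n -> C R}) : tensor R n :=
  \sum_(i : multiindex n) t i *: F i.
have f_lin : linear f.
  move=> a u v; rewrite /f scaler_sumr -big_split /=; apply: eq_bigr => k _.
  by rewrite !ffunE scalerA -scalerDl.
pose M := GRing.isLinear.Build _ _ _ _ f f_lin.
pose g : {linear tensor R n -> tensor R n} := HB.pack f M.
rewrite /lin_ext -[LHS]/(linfun g (basis_tensor i)) lfunE /= /f (bigD1 i) //=.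
rewrite basis_tensorE eqxx scale1r big1 ?addr0 // => k nki.
by rewrite basis_tensorE (negPf nki) scale0r.
Qed.

(* sigma (v_{i_1} (x) ... (x) v_{i_n}) has v_{i_{sigma^-1 k}} in position k *)
Definition perm_act (s : 'S_n) : 'End(tensor R n) :=
  lin_ext (fun i => basis_tensor [ffun k => i ((s^-1)%g k)]).

Definition mx_act (B : 'M[C R]_n) : 'End(tensor R n) :=
  lin_ext (fun i => pure_tensor (fun k => B *m stdbasis (i k))).

(* The operator-valued integral is taken coordinatewise. *)
Definition E_op (mu : probability (unitary R n) R) (A : 'M[C R]_n) :
    'End(tensor R n) :=
  lin_ext (fun i => [ffun j : multiindex n =>
    cintegral mu (fun u =>
      (mx_act (conj_unitary A u) (basis_tensor i) : {ffun _ -> _}) j)]).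

Definition is_submodule (V : {vspace tensor R n}) : Prop :=
  forall s : 'S_n, (perm_act s @: V <= V)%VS.

End Tensors.

(* The trace of f|_V, computed in a basis of V; it is meaningful when V is
   stable under f. *)
Definition trace_on (K : fieldType) (vT : vectType K) (f : 'End(vT))
    (V : {vspace vT}) : K :=
  \sum_(i < \dim V) coord (vbasis V) i (f (vbasis V)`_i).

Definition character_on (R : realType) (n : nat) (V : {vspace tensor R n})
    (s : 'S_n) : C R := trace_on (perm_act R s) V.

(* Main.v *)
Require Import Defs.
From mathcomp Require Import all_boot all_order all_algebra all_fingroup.
From mathcomp Require Import spectral complex ring.
From mathcomp Require Import all_classical all_reals all_analysis.
From mathcomp Require Import measurable_realfun.
Import numFieldNormedType.Exports.
Set Implicit Arguments.
Unset Strict Implicit.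
Unset Printing Implicit Defensive.
Import Order.TTheory GRing.Theory Num.Theory.
Local Open Scope classical_set_scope.
Local Open Scope ring_scope.
Local Open Scope sesquilinear_scope.

(* By invariance of the Haar measure, E_A commutes with W^{(x)n} for unitary W.
   An operator T with this property commutes with B^{(x)n} for every matrix B:
   for diagonal B because T preserves the weight spaces of the unitary torus,
   then for normal B by the spectral theorem, then for all B by polynomial
   continuation. Since there are as many basis vectors as tensor factors, T is
   determined by its value at v_1 (x) ... (x) v_n, which lies in the span of the
   permuted tensors v_{s^-1(1)} (x) ... (x) v_{s^-1(n)}; hence T is a
   combination of the permutation operators s. For T = E_A the coefficient of s is
   int prod_i A^u_{i s(i)} du, and the trace on V is linear. *)

(** * Tensor powers of matrices and the commutant of the unitary ones *)

Section TensorPower.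
Variables (K : numClosedFieldType) (n : nat).
Local Notation N := #|{: multiindex n}|.
Local Notation mi := (@enum_val (multiindex n) predT).
Implicit Types (i j : 'I_N) (B D : 'M[K]_n) (f g : multiindex n).

(** Multi-indices are enumerated by ordinals so that operators on tensors become square matrices, to
    which [diag_mx] and [comm_mx] apply. *)
Definition tensor_power B : 'M[K]_N :=
  \matrix_(j, i) \prod_(k < n) B (mi j k) (mi i k).

Lemma tensor_powerE B f g :
  tensor_power B (enum_rank f) (enum_rank g) = \prod_(k < n) B (f k) (g k).
Proof. by rewrite mxE !enum_rankK. Qed.

(** Distributivity turns a product over k of sums into a sum over all multi-indices. *)
Lemma tensor_powerM B D :
  tensor_power (B *m D) = tensor_power B *m tensor_power D.
Proof.
apply/matrixP => j i; rewrite !mxE.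
under eq_bigr do rewrite mxE.
rewrite bigA_distr_bigA /= (reindex mi) /=; last first.
  exact/onW_bij/enum_val_bij.
by apply: eq_bigr => l _; rewrite !mxE -big_split.
Qed.

Lemma tensor_power_diag (d : 'rV[K]_n) :
  tensor_power (diag_mx d) = diag_mx (\row_i \prod_(k < n) d 0 (mi i k)).
Proof.
apply/matrixP => j i; rewrite !mxE.
have [->|ne] := eqVneq j i.
  by rewrite mulr1n; apply: eq_bigr => k _; rewrite mxE eqxx mulr1n.
rewrite mulr0n; have [k nk] : exists k, mi j k != mi i k.
  apply/existsP; rewrite -negb_forall; apply: contra ne => /forallP h.
  by apply/eqP/enum_val_inj/ffunP => k; apply/eqP.
by rewrite (bigD1 k) //= mxE (negPf nk) mulr0n mul0r.
Qed.

(** This is the weight of the basis tensor of f under the diagonal torus: the exponents of the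
    monomial by which a diagonal matrix scales it. *)
Definition content f (m : 'I_n) : nat := #|[pred k | f k == m]|.

Lemma prod_content (d : 'I_n -> K) f :
  \prod_(k < n) d (f k) = \prod_(m < n) d m ^+ content f m.
Proof.
rewrite (partition_big f predT) //=; apply: eq_bigr => m _.
by rewrite -prodr_const; apply: eq_big => // k; move/eqP ->.
Qed.

(** Distinct characters of the circle differ somewhere. For a < b, a root z of -1 of order b - a
    gives z^b = - z^a, and z^a is nonzero. *)
Lemma unit_circle_exp_neq (a b : nat) : a != b ->
  exists2 z : K, z * z^* = 1 & z ^+ a != z ^+ b.
Proof.
wlog lt_ab : a b / (a < b)%N.
  move=> wl; rewrite neq_ltn => /orP[ab|ba].
    by apply: wl => //; rewrite neq_ltn ab.
  have [|z z1 zab] := wl b a ba; first by rewrite neq_ltn ba.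
  by exists z; rewrite // eq_sym.
move=> _; pose m := (b - a)%N; have m0 : (0 < m)%N by rewrite subn_gt0.
pose z : K := m.-root (-1); have zm : z ^+ m = -1 by rewrite rootCK.
have z1 : `|z| = 1.
  by apply/eqP; rewrite -(pexpr_eq1 m0) // -normrX zm normrN1.
exists z; first by rewrite -normCK z1 expr1n.
rewrite -(subnK (ltnW lt_ab)) exprD zm mulN1r -subr_eq0 opprK.
by rewrite -mulr2n mulrn_eq0 /= expf_eq0 negb_and -normr_eq0 z1 oner_eq0 orbT.
Qed.

Lemma diag_unitary (d : 'rV[K]_n) :
  (forall k, d 0 k * (d 0 k)^* = 1) -> diag_mx d \is unitarymx.
Proof.
move=> d1; apply/unitarymxP/matrixP => k l; rewrite mul_diag_mx !mxE.
have [->|ne] := eqVneq k l; first by rewrite !mulr1n d1.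
by rewrite mulr0n conjC0 mulr0.
Qed.

Section Commutant.
Variable T : 'M[K]_N.

Lemma comm_tensor_powerM B D :
  comm_mx T (tensor_power B) -> comm_mx T (tensor_power D) ->
  comm_mx T (tensor_power (B *m D)).
Proof. by rewrite tensor_powerM; exact: comm_mxM. Qed.

(** The tensor power of a diagonal matrix is diagonal, so each entry of the commutator is [T j i]
    times a difference of two diagonal entries. *)
Lemma comm_tensor_power_diagP (d : 'rV[K]_n) :
  comm_mx T (tensor_power (diag_mx d)) <->
  forall j i, T j i != 0 ->
    \prod_(k < n) d 0 (mi j k) = \prod_(k < n) d 0 (mi i k).
Proof.
rewrite tensor_power_diag; split=> [Td j i nz|Td].
  have /matrixP/(_ j i) := Td; rewrite mul_mx_diag mul_diag_mx !mxE mulrC.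
  by move/(mulIf nz) ->.
rewrite /comm_mx mul_mx_diag mul_diag_mx; apply/matrixP => j i.
rewrite !mxE mulrC.
by have [->|/Td ->//] := eqVneq (T j i) 0; rewrite !mulr0.
Qed.

Hypothesis T_unitary : forall W, W \is unitarymx -> comm_mx T (tensor_power W).

(** The unitary torus already separates weights, so a nonzero [T j i] forces equal contents, and
    then every diagonal matrix scales both basis tensors alike. *)
Lemma comm_tensor_power_diag (d : 'rV[K]_n) :
  comm_mx T (tensor_power (diag_mx d)).
Proof.
apply/comm_tensor_power_diagP => j i nz.
suff cont m : content (mi j) m = content (mi i) m.
  by rewrite !prod_content; apply: eq_bigr => m _; rewrite cont.
apply/eqP; apply/negPn/negP => /unit_circle_exp_neq [z z1] /negP; apply.
apply/eqP.
(* This torus element scales a basis tensor by z to the power of its content at m. *)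
pose dz : 'rV[K]_n := \row_k if k == m then z else 1.
have /comm_tensor_power_diagP/(_ _ _ nz) :
    comm_mx T (tensor_power (diag_mx dz)).
  apply/T_unitary/diag_unitary => k; rewrite mxE.
  by case: ifP => // _; rewrite conjC1 mulr1.
rewrite !prod_content (bigD1 m) //= [in X in _ = X -> _](bigD1 m) //= !mxE eqxx.
do 2 (rewrite big1 ?mulr1; last by move=> k /negPf nk; rewrite mxE nk expr1n).
by [].
Qed.

Lemma comm_tensor_power_normal B :
  B \is normalmx -> comm_mx T (tensor_power B).
Proof.
move/orthomx_spectralP => ->; rewrite invmx_unitary ?spectral_unitarymx //.
have US := spectral_unitarymx B.
apply: comm_tensor_powerM; last exact: T_unitary.
apply: comm_tensor_powerM; last exact: comm_tensor_power_diag.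
by apply: T_unitary; rewrite trmxC_unitary.
Qed.

(* With B = H + i L, H and L Hermitian, the commutator of T with the tensor
   power of H + t L is polynomial in t and vanishes for real t. *)
Lemma comm_tensor_power_all B : comm_mx T (tensor_power B).
Proof.
pose H : 'M[K]_n := 2^-1 *: (B + B^t*).
pose L : 'M[K]_n := - ('i / 2) *: (B - B^t*).
have BE : B = H + 'i *: L.
  apply/matrixP => k l; rewrite !mxE mulrA mulrN mulrA -expr2 sqrCi.
  by field.
(* Natural values of t suffice: they are infinitely many, and [H + t L] is then Hermitian, hence
   normal. *)
have HtL (m : nat) : comm_mx T (tensor_power (H + m%:R *: L)).
  apply: comm_tensor_power_normal; apply: hermitian_normalmx.
  apply/is_hermitianmxP; rewrite expr0 scale1r; apply/matrixP => k l.
  rewrite !mxE !rmorphD /= !rmorphM /= rmorphN rmorphM !rmorphD /= !rmorphN /=.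
  rewrite !conjCK conjCi !fmorphV !rmorph_nat.
  by field.
apply/matrixP => j i; clearbody H L.
pose P (a b : 'I_N) : {poly K} :=
  \prod_(k < n) ((H (mi a k) (mi b k))%:P
                 + L (mi a k) (mi b k) *: 'X).
pose Q : {poly K} := \sum_a (T j a)%:P * P a i - \sum_a P j a * (T a i)%:P.
have QE z : Q.[z] = (T *m tensor_power (H + z *: L)) j i
                    - (tensor_power (H + z *: L) *m T) j i.
  have PE a b : (P a b).[z] = tensor_power (H + z *: L) a b.
    rewrite horner_prod mxE; apply: eq_bigr => k _.
    by rewrite !mxE hornerD hornerC hornerZ hornerX mulrC.
  rewrite /Q hornerD hornerN !horner_sum 2![in RHS]mxE.
  by congr (_ - _); apply: eq_bigr => k _; rewrite !hornerM hornerC PE.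
have Q0 : Q = 0.
  (* A nonzero Q has fewer than [size Q] roots, but the naturals below [size Q] are that many
     distinct ones in characteristic zero. *)
  apply/eqP; apply: contraT => nzQ.
  rewrite -(ltnn (size Q)) -{1}[size Q](size_iota 0).
  rewrite -(size_map (fun m => m%:R : K)).
  apply: max_poly_roots => //.
    by apply/allP => _ /mapP[m _ ->]; rewrite /root QE HtL subrr.
  rewrite map_inj_uniq ?iota_uniq // => a b /eqP.
  by rewrite eqr_nat => /eqP.
have := QE 'i; rewrite -BE Q0 horner0 => /esym/eqP.
by rewrite subr_eq0 => /eqP.
Qed.

Definition id_index : multiindex n := [ffun k => k].

(** If f missed a value m, the diagonal matrix killing only v_m would fix the tensor of f and kill
    v_1 (x) ... (x) v_n, so T could not link the two. Hence f is onto, and injective by counting. *)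
Lemma comm_tensor_power_id_index f :
  T (enum_rank f) (enum_rank id_index) != 0 -> injective f.
Proof.
move=> nz; have surj m : m \in codom f.
  apply: contraT => fm.
  have /comm_tensor_power_diagP/(_ _ _ nz) :=
    comm_tensor_power_diag (\row_k (k != m)%:R).
  rewrite !enum_rankK [RHS](bigD1 m) //= ffunE mxE eqxx mul0r big1.
    by move/eqP; rewrite oner_eq0.
  by move=> k _; rewrite mxE; case: eqP => // fkm; rewrite -fkm codom_f in fm.
have /image_injP f_inj : #|[seq f x | x in 'I_n]| == #|'I_n|.
  by apply/eqP/eq_card => m; rewrite surj.
by move=> k l; exact: f_inj.
Qed.

Theorem commutant_unitary_tensor_power f g :
  T (enum_rank f) (enum_rank g) =
  \sum_(s : 'S_n) T (enum_rank [ffun k => (s^-1)%g k]) (enum_rank id_index)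
                  * (f == [ffun k => g ((s^-1)%g k)])%:R.
Proof.
(* M sends v_l to v_(g l), so its tensor power carries v_1 (x) ... (x) v_n to the basis tensor of g.
   Commuting T past it expresses column g of T through column [id_index]. *)
pose M : 'M[K]_n := \matrix_(k, l) (k == g l)%:R.
have ME f' h : tensor_power M (enum_rank f') (enum_rank h)
             = (f' == [ffun k => g (h k)])%:R.
  rewrite tensor_powerE; case: eqVneq => [->|/eqP ne].
    by rewrite big1 // => k _; rewrite mxE ffunE eqxx.
  have [k nk] : exists k, f' k != g (h k).
    apply/existsP; rewrite -negb_forall; apply/forallP => e.
    by apply: ne; apply/ffunP => k; rewrite ffunE; apply/eqP.
  by rewrite (bigD1 k) //= mxE (negPf nk) mul0r.
have /matrixP/(_ (enum_rank f) (enum_rank id_index)) := comm_tensor_power_all M.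
have -> : (T *m tensor_power M) (enum_rank f) (enum_rank id_index)
        = T (enum_rank f) (enum_rank g).
  rewrite mxE (bigD1 (enum_rank g)) //= ME.
  have -> : [ffun k => g (id_index k)] = g by apply/ffunP => k; rewrite !ffunE.
  rewrite eqxx mulr1 big1 ?addr0 // => a; rewrite -[a]enum_valK => ne.
  rewrite ME; case: eqP => [e|]; last by rewrite mulr0.
  case/eqP: ne; congr enum_rank; rewrite e.
  by apply/ffunP => k; rewrite !ffunE.
move=> ->; rewrite mxE.
pose pidx (s : 'S_n) : multiindex n := [ffun k => (s^-1)%g k].
have pidx_inj : injective pidx.
  move=> s s' /ffunP ss'; apply: invg_inj; apply/permP => k.
  by have := ss' k; rewrite !ffunE.
(* The sum over permutations is grouped by multi-index: a non-injective one has coefficient zero, an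
   injective one comes from exactly one s. *)
rewrite [RHS](partition_big (enum_rank \o pidx) predT) //=.
apply: eq_bigr => a _; rewrite mulrC -[a]enum_valK ME.
have [Ta0|/comm_tensor_power_id_index inj] :=
  eqVneq (T (enum_rank (mi a)) (enum_rank id_index)) 0.
  by rewrite Ta0 mul0r big1 // => s /eqP se; rewrite -/(pidx s) se Ta0 mul0r.
have pidxE : pidx (perm inj)^-1%g = mi a.
  by apply/ffunP => k; rewrite ffunE invgK permE.
rewrite -pidxE (bigD1 (perm inj)^-1%g) //= big1 ?addr0.
  by congr (_ * (_ == _)%:R); apply/ffunP => k; rewrite !ffunE.
by move=> s /andP[/eqP/enum_rank_inj/pidx_inj ->]; rewrite eqxx.
Qed.
End Commutant.
End TensorPower.

(** * Integration of bounded complex functions *)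

Section ComplexIntegral.
Context d (X : measurableType d) (R : realType) (mu : probability X R).
Implicit Types (f g : X -> R[i]).

(** Unlike integrability, this class is closed under products; it implies integrability because mu
    is finite. *)
Definition bounded_measurable f :=
  [/\ measurable_fun setT (fun x => complex.Re (f x)),
      measurable_fun setT (fun x => complex.Im (f x)) &
      exists c : R, forall x,
        `|complex.Re (f x)| <= c /\ `|complex.Im (f x)| <= c].

Lemma bounded_measurable_cst (a : R[i]) : bounded_measurable (fun=> a).
Proof.
split; [exact: measurable_cst|exact: measurable_cst|].
exists (Num.max `|complex.Re a| `|complex.Im a|) => _.
by rewrite !le_max !lexx orbT.
Qed.

Lemma bounded_measurableD f g : bounded_measurable f -> bounded_measurable g ->
  bounded_measurable (fun x => f x + g x).
Proof.
move=> [f1 f2 [c fc]] [g1 g2 [c' gc]]; split.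
- under eq_fun do rewrite raddfD /=; exact: measurable_funD.
- under eq_fun do rewrite raddfD /=; exact: measurable_funD.
exists (c + c') => x; rewrite !raddfD /=.
have [f1x f2x] := fc x; have [g1x g2x] := gc x.
by split; rewrite (le_trans (ler_normD _ _)) // lerD.
Qed.

Lemma ReM (a b : R[i]) :
  complex.Re (a * b) =
  complex.Re a * complex.Re b - complex.Im a * complex.Im b.
Proof. by case: a b => [? ?] []. Qed.

Lemma ImM (a b : R[i]) :
  complex.Im (a * b) =
  complex.Re a * complex.Im b + complex.Im a * complex.Re b.
Proof. by case: a b => [? ?] []. Qed.

Lemma bounded_measurableM f g : bounded_measurable f -> bounded_measurable g ->
  bounded_measurable (fun x => f x * g x).
Proof.
move=> [f1 f2 [c fc]] [g1 g2 [c' gc]]; split.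
- under eq_fun do rewrite ReM.
  by apply: measurable_funB; exact: measurable_funM.
- under eq_fun do rewrite ImM.
  by apply: measurable_funD; exact: measurable_funM.
exists (c * c' + c * c') => x; have [f1x f2x] := fc x; have [g1x g2x] := gc x.
rewrite ReM ImM; split.
  by rewrite (le_trans (ler_normB _ _)) // !normrM lerD // ler_pM.
by rewrite (le_trans (ler_normD _ _)) // !normrM lerD // ler_pM.
Qed.

Lemma bounded_measurable_conj f : bounded_measurable f ->
  bounded_measurable (fun x => (f x)^*).
Proof.
move=> [f1 f2 [c fc]].
have E x : (f x)^* = Complex (complex.Re (f x)) (- complex.Im (f x)).
  by case: (f x).
split.
- by under eq_fun do rewrite E.
- by under eq_fun do rewrite E /=; exact: measurableT_comp.
by exists c => x; rewrite E /= normrN.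
Qed.

Lemma bounded_measurable_sum (I : Type) (r : seq I) (P : pred I)
    (F : I -> X -> R[i]) :
  (forall i, bounded_measurable (F i)) ->
  bounded_measurable (fun x => \sum_(i <- r | P i) F i x).
Proof.
move=> mF; elim: r => [|i r IHr].
  under eq_fun do rewrite big_nil; exact: bounded_measurable_cst.
under eq_fun do rewrite big_cons; case: (P i) => //.
exact: bounded_measurableD.
Qed.

Lemma bounded_measurable_prod (I : Type) (r : seq I) (P : pred I)
    (F : I -> X -> R[i]) :
  (forall i, bounded_measurable (F i)) ->
  bounded_measurable (fun x => \prod_(i <- r | P i) F i x).
Proof.
move=> mF; elim: r => [|i r IHr].
  under eq_fun do rewrite big_nil; exact: bounded_measurable_cst.
under eq_fun do rewrite big_cons; case: (P i) => //.
exact: bounded_measurableM.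
Qed.

Lemma bounded_measurable_integrable f : bounded_measurable f ->
  mu.-integrable setT (EFin \o (fun x => complex.Re (f x))) /\
  mu.-integrable setT (EFin \o (fun x => complex.Im (f x))).
Proof.
move=> [f1 f2 [c fc]].
have muT : (mu setT < +oo)%E by rewrite probability_setT ltry.
split; apply: measurable_bounded_integrable => //; exists c.
  split; first exact: num_real.
  by move=> M cM x _ /=; rewrite (le_trans (fc x).1) // ltW.
split; first exact: num_real.
by move=> M cM x _ /=; rewrite (le_trans (fc x).2) // ltW.
Qed.

Lemma cintegralD f g : bounded_measurable f -> bounded_measurable g ->
  cintegral mu (fun x => f x + g x) = cintegral mu f + cintegral mu g.
Proof.
move=> /bounded_measurable_integrable[f1 f2].
move=> /bounded_measurable_integrable[g1 g2].
rewrite /cintegral.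
under eq_Rintegral do rewrite raddfD /=.
under [X in Complex _ X]eq_Rintegral do rewrite raddfD /=.
by rewrite !RintegralD.
Qed.

Lemma cintegralZl f (a : R[i]) : bounded_measurable f ->
  cintegral mu (fun x => a * f x) = a * cintegral mu f.
Proof.
move=> bf; have [f1 f2] := bounded_measurable_integrable bf.
rewrite /cintegral.
under eq_Rintegral do rewrite ReM.
under [X in Complex _ X]eq_Rintegral do rewrite ImM.
have IZ (b : R) h : mu.-integrable setT (EFin \o h) ->
    mu.-integrable setT (EFin \o (fun x => b * h x)).
  move=> ih; rewrite (_ : _ \o _ = fun x => (b%:E * (EFin \o h) x)%E) //.
  exact: integrableZl.
rewrite RintegralB ?RintegralD ?RintegralZl //; try exact: IZ.
by apply/eqP; rewrite eq_complex ReM ImM !eqxx.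
Qed.

Lemma cintegral0 : cintegral mu (fun=> 0 : R[i]) = 0 :> R[i].
Proof. by rewrite /cintegral !Rintegral_cst // !mul0r. Qed.

Lemma cintegral_sum (I : Type) (r : seq I) (P : pred I)
    (F : I -> X -> R[i]) :
  (forall i, bounded_measurable (F i)) ->
  cintegral mu (fun x => \sum_(i <- r | P i) F i x)
  = \sum_(i <- r | P i) cintegral mu (F i).
Proof.
move=> mF; elim: r => [|i r IHr].
  rewrite big_nil -[RHS]cintegral0; congr cintegral.
  by apply/funext => x; rewrite big_nil.
rewrite big_cons -IHr.
transitivity (cintegral mu (fun x =>
    if P i then F i x + \sum_(j <- r | P j) F j x
    else \sum_(j <- r | P j) F j x)).
  by congr cintegral; apply/funext => x; rewrite big_cons.
case: (P i) => //; apply: cintegralD => //.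
exact: bounded_measurable_sum.
Qed.
End ComplexIntegral.

(** * Measurability on the unitary group and translation invariance of the integral *)

Section Haar.
Variables (R : realType) (n : nat).
Implicit Types (A : 'M[C R]_n) (u w : unitary R n).

Lemma unitary_open_measurable (B : set (unitary R n)) : open B -> measurable B.
Proof. by move=> oB; exact: sub_sigma_algebra. Qed.

Lemma unitary_entry_continuous i j :
  continuous (fun u : unitary R n => val u i j).
Proof.
move=> u.
have vc : {for u, continuous (val : unitary R n -> 'M[C R]_n)}.
  exact: initial_continuous.
have := continuous_comp vc (@coord_continuous (C R) n n i j (val u)).
exact.
Qed.

(** The norm of a complex number is itself complex-valued, so the real radius is embedded for the
    comparison. *)
Lemma ltc_Re (z : R[i]) (e : R) : `|z| < (e%:C)%C -> `|complex.Re z| < e.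
Proof. by rewrite -ltcR; apply: le_lt_trans; exact: normc_ge_Re. Qed.

Lemma ltc_Im (z : R[i]) (e : R) : `|z| < (e%:C)%C -> `|complex.Im z| < e.
Proof.
(* Multiplication by i preserves the norm and turns the imaginary part into minus the real part. *)
move=> ze; rewrite -normrN -ReiNIm; apply: ltc_Re.
by rewrite normrM complexiE normCi mulr1.
Qed.

Lemma continuous_Re : continuous (fun z : C R => complex.Re z : R).
Proof.
move=> z s /nbhs_ballP[e e0 es]; apply/nbhs_ballP.
exists (e%:C)%C; first by rewrite /= ltcR.
by move=> w zw; apply: es; rewrite /ball /= -raddfB /=; exact: ltc_Re.
Qed.

Lemma continuous_Im : continuous (fun z : C R => complex.Im z : R).
Proof.
move=> z s /nbhs_ballP[e e0 es]; apply/nbhs_ballP.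
exists (e%:C)%C; first by rewrite /= ltcR.
by move=> w zw; apply: es; rewrite /ball /= -raddfB /=; exact: ltc_Im.
Qed.

Lemma continuous_unitary_measurable (f : unitary R n -> R) :
  continuous f -> measurable_fun setT f.
Proof.
move=> /continuousP cf; apply: (measurability _ (RGenOpens.measurableE R)).
move=> _ [_ [a [b ->] <-]]; rewrite setTI; apply: unitary_open_measurable.
exact/cf/interval_open.
Qed.

(** The squared moduli in row i sum to the diagonal entry of u u^*, which is 1. *)
Lemma unitary_entry_le1 u i j : `|val u i j| <= 1.
Proof.
have /unitarymxP/matrixP/(_ i i) := valP u; rewrite !mxE eqxx => uu.
have le1 : `|val u i j| ^+ 2 <= 1.
  rewrite -[leRHS]uu (bigD1 j) //= !mxE -normCK lerDl.
  by apply: sumr_ge0 => k _; rewrite !mxE -normCK exprn_ge0.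
by rewrite -(@ler_pXn2r _ 2) ?expr1n ?nnegrE.
Qed.

Lemma bounded_measurable_entry i j :
  bounded_measurable (fun u : unitary R n => val u i j : R[i]).
Proof.
split.
- apply: continuous_unitary_measurable => u.
  exact: (continuous_comp (@unitary_entry_continuous i j u) (@continuous_Re _)).
- apply: continuous_unitary_measurable => u.
  exact: (continuous_comp (@unitary_entry_continuous i j u) (@continuous_Im _)).
(* The entries are at most 1; the bound 2 provides the strict inequality that [ltc_Re] and [ltc_Im]
   ask for. *)
exists 2 => u; have lt2 : `|val u i j : R[i]| < ((2 : R)%:C)%C.
  apply: (le_lt_trans (unitary_entry_le1 u i j)).
  by rewrite rmorph_nat ltr1n.
by split; apply/ltW; [exact: ltc_Re|exact: ltc_Im].
Qed.

Lemma bounded_measurable_conj_unitary A i j :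
  bounded_measurable (fun u : unitary R n => conj_unitary A u i j : R[i]).
Proof.
rewrite /conj_unitary.
under eq_fun do rewrite mxE.
apply: bounded_measurable_sum => k; apply: bounded_measurableM.
  under eq_fun do rewrite mxE.
  apply: bounded_measurable_sum => l; apply: bounded_measurableM.
    exact: bounded_measurable_entry.
  exact: bounded_measurable_cst.
under eq_fun do rewrite !mxE.
apply: bounded_measurable_conj; exact: bounded_measurable_entry.
Qed.

Lemma continuous_mulmx_unitary w : continuous (fun M : 'M[C R]_n => val w *m M).
Proof.
move=> M S /nbhs_ballP[e e0 eS]; apply/nbhs_ballP.
have n0 : 0 < n.+1%:R :> C R by rewrite ltr0n.
(* Each entry of the product changes by at most n terms of this size, since entries of w are bounded
   by 1. Dividing by n + 1 keeps the total strictly below e. *)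
exists (e / n.+1%:R) => [|N [_ MN]]; first by rewrite /= divr_gt0.
apply: eS; split=> // i j; rewrite /ball /= !mxE -sumrB.
apply: le_lt_trans (ler_norm_sum _ _ _) _.
apply: (@le_lt_trans _ _ (\sum_(k < n) e / n.+1%:R)).
  apply: ler_sum => k _; rewrite -mulrBr normrM -[leRHS]mul1r.
  by rewrite ler_pM // ?unitary_entry_le1 // ltW //; exact: MN.
rewrite sumr_const card_ord -[_ *+ n]mulr_natr mulrAC -mulrA gtr_pMr //.
by rewrite ltr_pdivrMr // mul1r ltr_nat.
Qed.

Lemma continuous_unitaryM w : continuous (unitaryM w).
Proof.
apply/continuousP => _ [B oB <-].
exists ((fun M : 'M[C R]_n => val w *m M) @^-1` B) => //.
by move/continuousP : (@continuous_mulmx_unitary w); exact.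
Qed.

Lemma measurable_unitaryM w : measurable_fun setT (unitaryM w).
Proof.
apply: (@measurability _ _ (unitary R n) (unitary R n) setT (unitaryM w) open).
  by [].
move=> _ [B oB <-]; rewrite setTI; apply: unitary_open_measurable.
by move/continuousP : (@continuous_unitaryM w); exact.
Qed.

Lemma bounded_measurable_unitaryM w (f : unitary R n -> R[i]) :
  bounded_measurable f -> bounded_measurable (fun u => f (unitaryM w u)).
Proof.
move=> [f1 f2 [c fc]]; split; last by exists c => u; exact: fc.
  exact: (measurableT_comp f1 (measurable_unitaryM w)).
exact: (measurableT_comp f2 (measurable_unitaryM w)).
Qed.

Variables (mu : probability (unitary R n) R).
Hypothesis haar_mu : is_haar mu.

(** The left side is the integral of f against the pushforward of mu under translation by w, which
    equals mu on measurable sets. *)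
Lemma haar_Rintegral w (f : unitary R n -> R) :
  mu.-integrable setT (EFin \o f) ->
  mu.-integrable setT (EFin \o (fun u => f (unitaryM w u))) ->
  Rintegral mu setT (fun u => f (unitaryM w u)) = Rintegral mu setT f.
Proof.
move=> intf intfw; rewrite /Rintegral.
have mf := measurable_int _ intf.
have := integral_pushforward (measurable_unitaryM w) mf intfw measurableT.
rewrite preimage_setT => <-; congr fine.
by apply: eq_measure_integral => [|mw B mB _];
  [exact: measurable_unitaryM|exact: haar_mu].
Qed.

Lemma haar_cintegral w (f : unitary R n -> C R) :
  bounded_measurable f ->
  cintegral mu (fun u => f (unitaryM w u)) = cintegral mu f.
Proof.
move=> bf; have bfw := bounded_measurable_unitaryM w bf.
have [f1 f2] := bounded_measurable_integrable mu bf.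
have [g1 g2] := bounded_measurable_integrable mu bfw.
by rewrite /cintegral; congr Complex;
  [exact: (haar_Rintegral f1 g1)|exact: (haar_Rintegral f2 g2)].
Qed.

End Haar.

(** * Traces, and the averaged operator as a combination of permutations *)

Lemma trace_on_sum (K : fieldType) (vT : vectType K) (I : finType) (c : I -> K)
    (F : I -> 'End(vT)) (V : {vspace vT}) :
  trace_on (\sum_i c i *: F i) V = \sum_i c i * trace_on (F i) V.
Proof.
rewrite /trace_on; under [RHS]eq_bigr do rewrite mulr_sumr.
rewrite exchange_big /=; apply: eq_bigr => k _.
rewrite sum_lfunE linear_sum; apply: eq_bigr => i _.
by rewrite scale_lfunE linearZ.
Qed.

Section Tensors.
Variables (R : realType) (n : nat).
Implicit Types (f g : multiindex n) (t : tensor R n).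

Lemma tensor_decomp t :
  t = \sum_f (t : {ffun multiindex n -> C R}) f *: basis_tensor R f.
Proof.
apply/ffunP => g; rewrite sum_ffunE (bigD1 g isT) big1.
  by rewrite ffunE basis_tensorE eqxx [_ *: _]mulr1; apply/esym/addr0.
move=> f /negPf; rewrite eq_sym ffunE basis_tensorE => ->.
exact: mulr0.
Qed.

Lemma eq_on_basis (S T : 'End(tensor R n)) :
  (forall f, S (basis_tensor R f) = T (basis_tensor R f)) -> S = T.
Proof.
move=> ST; apply/lfunP => t; rewrite (tensor_decomp t) !linear_sum.
by apply: eq_bigr => f _; rewrite !linearZ; congr (_ *: _); exact: ST.
Qed.

Lemma mx_act_basisE (B : 'M[C R]_n) f g :
  (mx_act B (basis_tensor R g) : {ffun _ -> C R}) f =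
  \prod_(k < n) B (f k) (g k).
Proof.
rewrite lin_ext_basis ffunE; apply: eq_bigr => k _.
rewrite mxE (bigD1 (g k)) //= mxE !eqxx mulr1 big1 ?addr0 // => l /negPf ne.
by rewrite mxE ne mulr0.
Qed.

Variables (mu : probability (unitary R n) R) (A : 'M[C R]_n).
Hypothesis haar_mu : is_haar mu.

Lemma bounded_measurable_tensor_power a b : bounded_measurable
  (fun u : unitary R n => tensor_power (conj_unitary A u) a b : R[i]).
Proof.
under eq_fun do rewrite mxE.
by apply: bounded_measurable_prod => k; exact: bounded_measurable_conj_unitary.
Qed.

(** This is the matrix of E_A in the enumerated basis of tensors. *)
Definition tensor_power_mean : 'M[C R]_#|{: multiindex n}| :=
  \matrix_(a, b) cintegral mu (fun u => tensor_power (conj_unitary A u) a b).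

(** Since W A^u = A^(wu) W, multiplying the mean by W on the left amounts to translating u by w and
    multiplying on the right; invariance removes the translation. *)
Lemma comm_tensor_power_mean W : W \is unitarymx ->
  comm_mx tensor_power_mean (tensor_power W).
Proof.
move=> UW; pose w : unitary R n := exist _ W UW.
have WA u : W *m conj_unitary A u = conj_unitary A (unitaryM w u) *m W.
  by rewrite /conj_unitary /= trmx_mul map_mxM !mulmxA mulmxKtV.
apply/matrixP => a b; rewrite !mxE.
transitivity (cintegral mu (fun u =>
    (tensor_power W *m tensor_power (conj_unitary A u)) a b)).
  have -> : (fun u => (tensor_power W *m tensor_power (conj_unitary A u)) a b) =
     (fun u => \sum_c tensor_power W c b
                * tensor_power (conj_unitary A (unitaryM w u)) a c).
    apply/funext => u; rewrite -tensor_powerM WA tensor_powerM mxE.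
    by apply: eq_bigr => c _; rewrite mulrC.
  have bm c : bounded_measurable (fun u : unitary R n =>
      tensor_power (conj_unitary A (unitaryM w u)) a c : R[i]).
    exact: bounded_measurable_unitaryM (bounded_measurable_tensor_power a c).
  rewrite cintegral_sum => [|c]; last first.
    by apply: bounded_measurableM; first exact: bounded_measurable_cst.
  apply: eq_bigr => c _; rewrite cintegralZl; last exact: bm.
  rewrite mxE mulrC.
  have E := haar_cintegral haar_mu w (bounded_measurable_tensor_power a c).
  exact: (congr1 ( *%R _) (esym E)).
have -> : (fun u => (tensor_power W *m tensor_power (conj_unitary A u)) a b) =
     (fun u => \sum_c tensor_power W a c * tensor_power (conj_unitary A u) c b).
  by apply/funext => u; rewrite mxE.
rewrite cintegral_sum => [|c].
  apply: eq_bigr => c _; rewrite cintegralZl ?mxE //.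
  exact: bounded_measurable_tensor_power.
apply: bounded_measurableM; first exact: bounded_measurable_cst.
exact: bounded_measurable_tensor_power.
Qed.

(** The mean lies in the commutant of the unitary tensor powers, so its column at [id_index]
    supplies the coefficients. *)
Lemma E_op_perm_act : E_op mu A = \sum_(s : 'S_n)
  cintegral mu (fun u => \prod_(k < n) conj_unitary A u k (s k))
    *: perm_act R s.
Proof.
apply: eq_on_basis => g; rewrite lin_ext_basis sum_lfunE.
apply/ffunP => f; rewrite ffunE sum_ffunE.
transitivity (tensor_power_mean (enum_rank f) (enum_rank g)).
  rewrite mxE; congr cintegral; apply/funext => u.
  by rewrite mx_act_basisE tensor_powerE.
rewrite commutant_unitary_tensor_power; last exact: comm_tensor_power_mean.
apply: eq_bigr => s _; rewrite scale_lfunE lin_ext_basis ffunE basis_tensorE.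
congr (_ * _); rewrite mxE; congr cintegral; apply/funext => u.
(* The coefficient appears with factors at (s^-1 k, k); replacing k by s k gives the factors at (k,
   s k). *)
rewrite tensor_powerE (reindex_inj (@perm_inj _ s)) /=.
by apply: eq_bigr => k _; rewrite !ffunE permK.
Qed.
End Tensors.

Theorem lemma7 (R : realType) (n : nat) (hn : (1 <= n)%N)
    (du : probability (unitary R n) R) (hdu : is_haar du)
    (V : {vspace tensor R n}) (hV : is_submodule V) (A : 'M[C R]_n) :
  (E_op du A @: V <= V)%VS /\
  trace_on (E_op du A) V =
    \sum_(s : 'S_n) character_on V s *
      cintegral du (fun u => \prod_(i < n) conj_unitary A u i (s i)).
Proof.
rewrite (E_op_perm_act A hdu); split.
  (* Each permutation operator preserves V, hence so does their combination. *)
  apply/subvP => _ /memv_imgP[v Vv ->]; rewrite sum_lfunE.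
  apply: memv_suml => s _.
  by rewrite scale_lfunE memvZ //; apply: (subvP (hV s)); exact: memv_img.
by rewrite trace_on_sum; apply: eq_bigr => s _; rewrite mulrC.
Qed.
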